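(* For any $\varepsilon\in(0,1)$ there exists $\delta>0$ (depending only on $\varepsilon$) such that if $\xi_1,\ldots,\xi_N$ are independent real random variables with $\inf_{c\in\mathbb{R}}\|\xi_i-c\|_{L_0}\ge\varepsilon$ for $i=1,\ldots,N$, then $$ d_n^{\mathrm{avg}}(\{\xi_1,\ldots,\xi_N\},L_0)\ge\delta\quad\text{if } n\le\delta N. $$
   Context: $L_0$ is the space of all real random variables on the underlying probability space $(\Omega,\mathsf{P})$ (modulo a.s. equality), with $\|f\|_{L_0}:=\sup\{t\ge 0\colon \mathsf{P}(|f|\ge t)\ge t\}$; the distance between $f$ and $g$ is $\|f-g\|_{L_0}$ (the Ky Fan metric). For a finite system in $L_0$, $d_n^{\mathrm{avg}}(\{x_1,\ldots,x_N\},L_0):=\inf_{Q_n}\frac1N\sum_{i=1}^N\rho(x_i,Q_n)$, where $\rho(x,Q)=\inf_{y\in Q}\|x-y\|_{L_0}$ and the infimum is over linear subspaces $Q_n\subset L_0$ of dimension at most $n$. *)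

(* Defs.v *)
From HB Require Import structures.
From mathcomp Require Import all_boot all_order all_algebra.
From mathcomp Require Import all_classical all_reals all_analysis.
(* Not exported by all_analysis, but it carries the algebraic structures of
   {mfun T >-> R}. *)
From mathcomp Require Import measurable_realfun.

Set Implicit Arguments.
Unset Strict Implicit.
Unset Printing Implicit Defensive.

Import Order.TTheory GRing.Theory Num.Theory.
Import numFieldNormedType.Exports.

Local Open Scope classical_set_scope.
Local Open Scope ring_scope.

Section L0_space.
Context d (T : measurableType d) (R : realType) (P : probability T R).

Definition L0 : Type := {mfun_ P, T >-> R}.

HB.instance Definition _ := Choice.on L0.
HB.instance Definition _ := EqQuotient.on L0.

Local Open Scope quotient_scope.

Definition toL0 (X : {mfun T >-> R}) : L0 := \pi_L0 X.

Lemma toL0_eqP (X Y : {mfun T >-> R}) :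
  toL0 X = toL0 Y <-> (X = Y %[ae P]).
Proof.
split; first by move=> /eqquotP/asboolP.
by move=> h; apply/eqquotP/asboolP.
Qed.

Lemma repr_toL0 (X : {mfun T >-> R}) : repr (toL0 X) = X %[ae P].
Proof. by apply/toL0_eqP; rewrite /toL0 reprK. Qed.

Definition L0_zero : L0 := toL0 0.
Definition L0_opp (f : L0) : L0 := toL0 (- repr f).
Definition L0_add (f g : L0) : L0 := toL0 (repr f + repr g).
Definition L0_scale (a : R) (f : L0) : L0 := toL0 (a *: repr f).

Lemma toL0N (X : {mfun T >-> R}) : L0_opp (toL0 X) = toL0 (- X).
Proof.
by apply/toL0_eqP; apply: filterS (repr_toL0 X) => x /[!mfunN]/= h xT; rewrite h.
Qed.

Lemma toL0D (X Y : {mfun T >-> R}) : L0_add (toL0 X) (toL0 Y) = toL0 (X + Y).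
Proof.
apply/toL0_eqP; apply: filterS2 (repr_toL0 X) (repr_toL0 Y) => x.
by rewrite !mfunD /= => hX hY xT; rewrite hX ?hY.
Qed.

Lemma toL0Z a (X : {mfun T >-> R}) : L0_scale a (toL0 X) = toL0 (a *: X).
Proof.
apply/toL0_eqP; apply: filterS (repr_toL0 X) => x h xT.
have E (Z : {mfun T >-> R}) : (a *: Z) x = a * Z x by [].
by rewrite !E h.
Qed.

Let toL0_ind (Q : L0 -> Prop) : (forall X, Q (toL0 X)) -> forall f, Q f.
Proof. by move=> h f; rewrite -[f]reprK; exact: h. Qed.

Let addA : associative L0_add.
Proof.
elim/toL0_ind=> X; elim/toL0_ind=> Y; elim/toL0_ind=> Z.
by rewrite !toL0D addrA.
Qed.

Let addC : commutative L0_add.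
Proof. by elim/toL0_ind=> X; elim/toL0_ind=> Y; rewrite !toL0D addrC. Qed.

Let add0 : left_id L0_zero L0_add.
Proof. by elim/toL0_ind=> X; rewrite toL0D add0r. Qed.

Let addN : left_inverse L0_zero L0_opp L0_add.
Proof. by elim/toL0_ind=> X; rewrite toL0N toL0D addNr. Qed.

HB.instance Definition _ := GRing.isZmodule.Build L0 addA addC add0 addN.

Let scaleA a b (f : L0) : L0_scale a (L0_scale b f) = L0_scale (a * b) f.
Proof. by elim/toL0_ind: f => X; rewrite !toL0Z scalerA. Qed.

Let scale1 : left_id 1 L0_scale.
Proof. by elim/toL0_ind=> X; rewrite toL0Z scale1r. Qed.

Let scaleDr : right_distributive L0_scale +%R.
Proof.
move=> a; elim/toL0_ind=> X; elim/toL0_ind=> Y.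
by rewrite /GRing.add/= /GRing.add/= !(toL0D, toL0Z) scalerDr.
Qed.

Let scaleDl (f : L0) : {morph L0_scale^~ f : a b / a + b}.
Proof.
elim/toL0_ind: f => X a b; rewrite !toL0Z scalerDl.
by rewrite -toL0D.
Qed.

HB.instance Definition _ := GRing.Zmodule_isLmodule.Build R L0
  scaleA scale1 scaleDr scaleDl.

(* Computed on a representative; ky_fan_toL0 shows it does not depend on it. *)
Definition ky_fan (f : L0) : R :=
  sup [set t : R | 0 <= t /\ (t%:E <= P [set w | (t <= `|repr f w|)%R])%E].

Lemma ky_fan_toL0 (X : {mfun T >-> R}) :
  ky_fan (toL0 X) =
  sup [set t : R | 0 <= t /\ (t%:E <= P [set w | (t <= `|X w|)%R])%E].
Proof.
have mlvl (Y : {mfun T >-> R}) t : measurable [set w | t <= `|Y w|].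
  rewrite -[X in measurable X]setTI.
  have mY : measurable_fun setT (fun w => `|Y w|).
    by apply: measurableT_comp => //; exact: measurable_funPT.
  have := mY measurableT _ (measurable_itv `[t, +oo[).
  congr (measurable _); apply/seteqP; split=> w /=;
    by rewrite in_itv/= andbT.
have le_lvl (Y Z : {mfun T >-> R}) t : Y = Z %[ae P] ->
    (P [set w | (t <= `|Y w|)%R] <= P [set w | (t <= `|Z w|)%R])%E.
  move=> [N [mN N0 sN]].
  rewrite -[leRHS]adde0 -N0.
  apply: le_trans (measureU2 P (mlvl Z t) mN).
  apply: le_measure; rewrite ?inE; [exact: mlvl|exact: measurableU|].
  move=> w /= tY; have [Nw|Nw] := pselect (N w); first by right.
  left; suff <- : Y w = Z w by [].
  by apply: contrapT => YZ; apply: Nw; apply: sN => /= /(_ I).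
congr sup; apply/seteqP; split=> t /= [t0 tX]; split=> //;
  apply: (le_trans tX); apply: le_lvl; first exact: repr_toL0.
by apply: filterS (repr_toL0 X) => w h wT; rewrite h.
Qed.

End L0_space.

Arguments toL0 {d T R} P X.

Section linear_subspaces.
Context (R : nzRingType) (V : lmodType R).

Definition is_basis m (v : 'I_m -> V) (Q : set V) :=
  (forall a : 'I_m -> R, \sum_(i < m) a i *: v i = 0 -> forall i, a i = 0) /\
  Q = range (fun a : 'I_m -> R => \sum_(i < m) a i *: v i).

Definition subspace_dim_le (n : nat) : set (set V) :=
  [set Q | submod_closed (mem Q) /\
    exists2 m : nat, (m <= n)%N & exists v : 'I_m -> V, is_basis v Q].

End linear_subspaces.

Section widths.
Context d (T : measurableType d) (R : realType) (P : probability T R).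

Definition dist_to (x : L0 P) (Q : set (L0 P)) : R :=
  inf [set ky_fan (x - y) | y in Q].

(* Only meaningful for 0 < N: for N = 0 this is 0, since 0^-1 = 0. *)
Definition avg_width (n N : nat) (x : 'I_N -> L0 P) : R :=
  inf [set N%:R^-1 * \sum_(i < N) dist_to (x i) Q
      | Q in @subspace_dim_le R (L0 P) n].

Definition mutually_independent (N : nat) (X : 'I_N -> {RV P >-> R}) :=
  forall (J : {set 'I_N}) (B : 'I_N -> set R),
    (forall i, measurable (B i)) ->
    (P (\bigcap_(i in [set` J]) (X i @^-1` B i)) =
     \prod_(i in J) P (X i @^-1` B i))%E.

End widths.

Arguments mutually_independent {d T R} P {N} X.

(* Main.v *)
Require Import Defs.
From mathcomp Require Import all_boot all_order all_algebra.
From mathcomp Require Import all_classical all_reals all_analysis.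
From mathcomp Require Import measurable_realfun.
From mathcomp Require Import lra.

(** Suppose a subspace [Q] of small dimension approximates the [xi i] well on
    average.  Then there are [Y i] in [Q] such that, with probability more than
    one half, [`|xi i - Y i| < eta] for all but a small proportion of the indices
    [i].  Two facts contradict each other.

    On the one hand [Q] has few sign patterns.  The [Y i] are combinations of
    [m] functions, so for each outcome the vector of their values lies in a fixed
    subspace of [R^N] of dimension at most [m].  For any thresholds, the family of sets
    [{i | Y i > threshold i}] obtained from that subspace shatters no set of more
    than [m] indices ([shatters_sign_patterns]), because [m + 1] coordinates are
    linearly dependent.  By the Sauer-Shelah lemma ([card_shatter_le]) it has at
    most as many members as there are sets of at most [m] indices.

    On the other hand the [xi i] follow no prescribed pattern.  A variable far
    from all constants has a gap: with [p = eps / 4], it is at most [a i] with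
    probability at least [p], and at least [a i + eps / 2] with probability at
    least [p] ([quantile_gap]).  Take the middle of the gap as threshold.  If
    [Y i] is close to [xi i], its sign relative to the threshold rules out one
    end of the gap.  By independence, agreement with a given sign pattern at
    [N - k] given indices has probability at most [(1 - p) ^ (N - k)].

    The union bound over sign patterns and over the at most [k] exceptional
    indices ([near_subspace_le]) gives twice a binomial entropy with arbitrarily
    small rate against a fixed exponential decay, hence a probability at most one
    half as soon as [N >= 2 / p] ([union_bound_half]).  Markov's inequality for
    the number of exceptional indices ([markov_count]) turns this into the lower
    bound for the average distance ([avg_dist_ge]).  When [N] is below
    [1 / delta], the condition [n <= delta N] forces [n = 0], and the distance
    to the zero subspace is at least [eps] by hypothesis. *)

Set Implicit Arguments.
Unset Strict Implicit.
Unset Printing Implicit Defensive.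

Import Order.TTheory GRing.Theory Num.Theory.
Import numFieldNormedType.Exports.

Local Open Scope ring_scope.

(** * Shattered sets and the Sauer-Shelah lemma *)

Section shattering.
(* The finite-set lemmas are shadowed by their namesakes on classical sets. *)
Import mathcomp.boot.fintype mathcomp.boot.finset.
Local Open Scope nat_scope.
Variable I : finType.
Implicit Types (F : {set {set I}}) (A B J : {set I}).

Definition shatters F J := [forall A in powerset J, [exists B in F, B :&: J == A]].

Lemma shattersP F J :
  reflect (forall A, A \subset J -> exists2 B, B \in F & B :&: J = A)
          (shatters F J).
Proof.
apply: (iffP forall_inP) => [sh A AJ|sh A /[!powersetE] AJ].
  have /exists_inP[B BF /eqP BA] := sh A ltac:(by rewrite powersetE).
  by exists B.
by apply/exists_inP; have [B BF BA] := sh A AJ; exists B => //; apply/eqP.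
Qed.

Lemma shattersS F F' J : F \subset F' -> shatters F J -> shatters F' J.
Proof.
move=> /subsetP FF' /shattersP sh; apply/shattersP => A /sh[B BF <-].
by exists B => //; exact: FF'.
Qed.

(** Pajor's form of the Sauer-Shelah lemma.  Splitting [F] by membership of a
    point [x] separating two of its members, a set shattered by one half never
    contains [x], and a set [J] shattered by both halves yields a second
    shattered set [x |: J] of [F]; so the shattered sets of [F] are at least as
    many as those of the two halves together. *)
Lemma card_le_shattered F : #|F| <= #|[set J | shatters F J]|.
Proof.
have [m] := ubnP #|F|; elim: m F => // m IH F; rewrite ltnS => Fm.
have [F_le1|/card_gt1P[B0 [B1 [B0F B1F B01]]]] := leqP #|F| 1.
  have [->|/set0Pn[B BF]] := eqVneq F set0; first by rewrite cards0.
  apply: (leq_trans F_le1); rewrite card_gt0; apply/set0Pn; exists set0.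
  rewrite inE; apply/shattersP => A; rewrite subset0 => /eqP ->.
  by exists B => //; rewrite setI0.
have [x xB] : exists x, (x \in B0) != (x \in B1).
  by apply/existsP; apply: contraNT B01 => /existsPn h; apply/eqP/setP => x;
     apply/eqP; rewrite -[_ == _]negbK h.
pose G b := [set B in F | (x \in B) == b].
have GF b : G b \subset F by apply/subsetP => B; rewrite inE => /andP[].
have G_proper b : G b \proper F.
  apply/properP; split; first exact: GF.
  have [xb|xb] := eqVneq (x \in B0) b.
    by exists B1 => //; rewrite inE -xb eq_sym (negbTE xB) andbF.
  by exists B0 => //; rewrite inE (negbTE xb) andbF.
have IHG b : #|G b| <= #|[set J | shatters (G b) J]|.
  by apply: IH; apply: leq_trans Fm; exact: proper_card.
have cardF : #|F| = #|G true| + #|G false|.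
  rewrite -(cardsID [set B : {set I} | x \in B] F); congr (_ + _);
    by apply: eq_card => B; rewrite !inE ?eqb_id ?eqbF_neg // andbC.
have xNG b J : shatters (G b) J -> x \notin J.
  move=> /shattersP sh; apply/negP => xJ.
  have [|B] := sh (if b then set0 else [set x]).
    by case: b {sh}; rewrite ?sub0set ?sub1set.
  rewrite inE => /andP[_ /eqP xB'] /setP/(_ x).
  by rewrite inE xJ xB'; case: b {sh xB'}; rewrite !inE ?eqxx.
pose S b := [set J | shatters (G b) J].
have SF b : S b \subset [set J | shatters F J].
  by apply/subsetP => J; rewrite !inE; apply: shattersS; exact: GF.
have inj : {in S true :&: S false &, injective (fun J => x |: J)}.
  move=> J J' /[!inE] /andP[/xNG xJ _] /andP[/xNG xJ' _] eqJ.
  by rewrite -(setU1K xJ) eqJ setU1K.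
rewrite cardF; apply: (leq_trans (leq_add (IHG _) (IHG _))).
rewrite -/(S true) -/(S false) -cardsUI -(card_in_imset inj) -cardsUI.
rewrite [X in _ + X](_ : _ = 0) ?addn0; last first.
  apply/eqP; rewrite cards_eq0; apply/eqP/setP => J; rewrite [RHS]inE.
  apply/negP => /setIP[xJ /imsetP[J' _ eqJ]].
  have : x \in J by rewrite eqJ setU11.
  by move: xJ; rewrite !inE => /orP[] /xNG /negbTE ->.
apply/subset_leq_card/subsetP => J /setUP[].
  by move=> /setUP[]; exact/subsetP.
move=> /imsetP[J' /[!inE] /andP[shT shF] ->].
have xJ' := xNG _ _ shT.
apply/shattersP => A AJ.
have [B BG BA] : exists2 B, B \in G (x \in A) & B :&: J' = A :\ x.
  have AJ' : A :\ x \subset J' by rewrite subDset.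
  by case: (x \in A); [move/shattersP: shT|move/shattersP: shF]; apply.
move: BG; rewrite inE => /andP[BF /eqP xBA].
exists B => //; apply/setP => y; move/setP/(_ y): BA; rewrite !inE.
by have [->|_] /= := eqVneq y x; first by rewrite andbT.
Qed.

Lemma card_shatter_le F n : (forall J, shatters F J -> #|J| <= n) ->
  #|F| <= #|[set J : {set I} | #|J| <= n]|.
Proof.
move=> h; apply: leq_trans (card_le_shattered F) _.
by apply/subset_leq_card/subsetP => J; rewrite !inE; exact: h.
Qed.

End shattering.

(** * Sign patterns of a finite-dimensional subspace *)

Section affine_patterns.
Import mathcomp.boot.fintype mathcomp.boot.finset.
Variables (R : realFieldType) (I : finType) (n : nat).
Variables (a : I -> 'I_n -> R) (m : I -> R).

(** The cells, up to boundaries, of the arrangement of the affine hyperplanes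
    [\sum_k c k * a i k = m i] in the space of the [c]. *)
Definition sign_patterns : {set {set I}} :=
  [set s | `[< exists c : 'I_n -> R,
               s = [set i | m i < \sum_k c k * a i k] >]].

Lemma dependent_rows (J : {set I}) : (n < #|J|)%N ->
  exists w : I -> R, [/\ exists i, w i != 0, forall i, i \notin J -> w i = 0
    & forall c : 'I_n -> R, \sum_(i in J) w i * \sum_k c k * a i k = 0].
Proof.
move=> nJ; pose A := \matrix_(j < #|J|, k < n) a (enum_val j) k.
have : kermx A != 0.
  rewrite kermx_eq0 /row_free; apply/negP => /eqP rA.
  by have := rank_leq_col A; rewrite rA leqNgt nJ.
case/rowV0Pn => w /sub_kermxP wA w0.
have [i0 i0J] : exists i0, i0 \in J.
  by apply/set0Pn; rewrite -card_gt0; apply: leq_trans nJ.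
pose v i := if i \in J then w 0 (enum_rank_in i0J i) else 0.
exists v; split.
- case/rV0Pn: w0 => j wj; exists (enum_val j).
  by rewrite /v enum_valP enum_valK_in.
- by move=> i /negbTE; rewrite /v => ->.
move=> c.
have -> : \sum_(i in J) v i * \sum_k c k * a i k =
    \sum_(k < n) c k * (w *m A) 0 k.
  under eq_bigr do rewrite mulr_sumr.
  rewrite exchange_big; apply: eq_bigr => k _; rewrite mxE mulr_sumr.
  rewrite big_enum_val.
  apply: eq_bigr => j _; rewrite /v enum_valP enum_valK_in mxE.
  by rewrite mulrCA.
by rewrite wA big1 // => k _; rewrite mxE mulr0.
Qed.

(** A dependency [w] of the rows in [J] annihilates every vector compared with
    [m].  Hence, if the pattern on [J] is the positivity set of [w], then
    [\sum_(i in J) w i * m i] is nonpositive; if it is that of [- w], the sum is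
    nonnegative; and one of the two inequalities is strict. *)
Lemma shatters_sign_patterns J : shatters sign_patterns J -> (#|J| <= n)%N.
Proof.
move=> /shattersP sh; rewrite leqNgt; apply/negP.
move=> /dependent_rows[w [[i0 wi0] wJ worth]].
have i0J : i0 \in J by apply: contraNT wi0 => /wJ ->.
(* Applied to [w] and to [- w]. *)
have key (v : I -> R) :
    (forall c : 'I_n -> R, \sum_(i in J) v i * \sum_k c k * a i k = 0) ->
    \sum_(i in J) v i * m i <= 0 /\
    (0 < v i0 -> \sum_(i in J) v i * m i < 0).
  move=> vorth.
  have [B] := sh [set i in J | 0 < v i] ltac:(by apply/subsetP=> i /[!inE]/andP[]).
  rewrite inE => /asboolP[c ->] eqB.
  have vc i : i \in J -> 0 <= v i * ((\sum_k c k * a i k) - m i).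
    move=> iJ; move/setP/(_ i): eqB; rewrite !inE iJ andbT /=.
    have [vi|vi] := ltP 0 (v i); last first.
      by move=> /negbT; rewrite -leNgt => h; rewrite mulr_le0 // subr_le0.
    by move=> h; rewrite mulr_ge0 ?ltW// subr_gt0.
  have E : \sum_(i in J) v i * m i =
      - \sum_(i in J) v i * ((\sum_k c k * a i k) - m i).
    under [in RHS]eq_bigr do rewrite mulrBr.
    by rewrite sumrB vorth sub0r opprK.
  rewrite E oppr_le0 oppr_lt0; split; first exact: sumr_ge0.
  move=> vi0; rewrite (bigD1 i0) //= ltr_pwDl //.
    move/setP/(_ i0): eqB; rewrite !inE i0J vi0 andbT /= => h.
    by rewrite mulr_gt0// subr_gt0.
  by apply: sumr_ge0 => i /andP[iJ _]; exact: vc.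
have [w1 w2] := key w worth.
have [|w3 w4] := key (fun i => - w i).
  by move=> c; under eq_bigr do rewrite mulNr; rewrite sumrN worth oppr0.
have E : \sum_(i in J) (- w i) * m i = - \sum_(i in J) w i * m i.
  by under eq_bigr do rewrite mulNr; rewrite sumrN.
move: w3 w4; rewrite E => w3 w4.
have [wp|wn|w0] := ltgtP (w i0) 0.
- have : 0 < - w i0 by lra.
  by move=> /w4; lra.
- by have := w2 wn; lra.
- by rewrite w0 eqxx in wi0.
Qed.

Lemma card_sign_patterns :
  (#|sign_patterns| <= #|[set J : {set I} | #|J| <= n]|)%N.
Proof. exact/card_shatter_le/shatters_sign_patterns. Qed.

End affine_patterns.

Local Open Scope classical_set_scope.
Local Open Scope ring_scope.

(** * Union bound and Markov's inequality for finitely many events *)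

Section finite_probability.
Context d (T : measurableType d) (R : realType) (P : probability T R).

Lemma union_bound (I : Type) (s : seq I) (Q : pred I) (A : I -> set T) :
    (forall i, Q i -> measurable (A i)) ->
  measurable (\big[setU/set0]_(i <- s | Q i) A i) /\
  (P (\big[setU/set0]_(i <- s | Q i) A i) <= \sum_(i <- s | Q i) P (A i))%E.
Proof.
move=> mA; pose K (X : set T) (y : \bar R) := measurable X /\ (P X <= y)%E.
apply: (big_ind2 K).
- by split; rewrite ?measure0.
- move=> X x Y y [mX Xx] [mY Yy]; split; first exact: measurableU.
  by apply: le_trans (leeD Xx Yy); exact: measureU2.
- by move=> i Qi; split => //; exact: mA.
Qed.

(** Restricting to a measurable [F] on which the count exceeds [k] dispenses with
    the measurability of the counting event itself. *)
Lemma markov_count (I : finType) (D : I -> set T) (F : set T) (k : nat) :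
    (forall i, measurable (D i)) -> measurable F ->
    (forall w, F w -> (k < #|[pred i | w \in D i]|)%N) ->
  ((k.+1%:R)%:E * P F <= \sum_i P (D i))%E.
Proof.
move=> mD mF FD.
have intE (A : set T) : measurable A -> P A = (\int[P]_w (\1_A w)%:E)%E.
  by move=> mA; rewrite integral_indic// setIT.
rewrite intE// -ge0_integralZl//; last first.
  by apply/measurable_EFinP; exact: measurable_indic.
under [leRHS]eq_bigr do rewrite intE//.
rewrite -ge0_integral_sum//; last first.
  by move=> i; apply/measurable_EFinP; exact: measurable_indic.
apply: ge0_le_integral => //.
- by apply/measurable_EFinP/measurable_funM => //; exact: measurable_indic.
- by apply: emeasurable_sum => i; apply/measurable_EFinP; exact: measurable_indic.
- move=> w _; rewrite sumEFin -EFinM lee_fin indicE.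
  have [wF|wF] := boolP (w \in F); last first.
    by rewrite mulr0 sumr_ge0.
  rewrite mulr1.
  have -> : \sum_i \1_(D i) w = #|[pred i | w \in D i]|%:R :> R.
    rewrite -sum1_card natr_sum [RHS]big_mkcond; apply: eq_bigr => i _.
    by rewrite indicE inE; case: (w \in D i).
  by rewrite ler_nat; apply: FD; rewrite inE in wF.
Qed.

End finite_probability.

(** * Gaps of a random variable far from all constants *)

Section quantile.
Context d (T : measurableType d) (R : realType) (P : probability T R).

(** Choose [a] with [X <= a] of probability at least [p] but [X <= a - t] of
    probability less than [p]; then [`|X - a| >= t] has probability at least
    [2 * p], of which the upper tail must carry [p]. *)
Lemma quantile_gap (X : {RV P >-> R}) (p t : R) : 0 < p -> p < 1 -> 0 < t ->
    (forall c, ((2 * p)%:E <= P [set w | (t <= `|X w - c|)%R])%E) ->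
  exists a, (p%:E <= P (X @^-1` `]-oo, a]))%E /\
            (p%:E <= P (X @^-1` `[(a + t)%R, +oo[))%E.
Proof.
move=> p0 p1 t0 Xt.
pose A := [set a : R | (p%:E <= cdf X a)%E].
have p0E : (0 < p%:E)%E by rewrite lte_fin.
have p1E : (p%:E < 1)%E by rewrite lte_fin.
have [a0 Aa0] : A !=set0.
  have near_a : \forall a \near +oo%R, (p%:E < cdf X a)%E.
    exact: (cvg_cdfy1 X (open_ereal_gt' p1E)).
  have [a /= pa] := filter_ex near_a.
  by exists a; exact: ltW.
have lbA : has_lbound A.
  have near_b : \forall b \near -oo%R, (cdf X b < p%:E)%E.
    exact: (cvg_cdfNy0 X (open_ereal_lt' p0E)).
  have [b /= bp] := filter_ex near_b.
  exists b => a /= Aa; rewrite leNgt; apply/negP => ab.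
  have := le_lt_trans (cdf_nondecreasing X (ltW ab)) bp.
  by rewrite ltNge Aa.
have hA : has_inf A by split; [exists a0|].
have [a Aa ainf] := inf_adherent t0 hA.
exists a; split; first by move: Aa.
have aA : (cdf X (a - t)%R < p%:E)%E.
  by rewrite ltNge; apply/negP => /(ge_inf lbA); lra.
have mX B : measurable B -> measurable (X @^-1` B).
  by move=> mB; rewrite -[X in measurable X]setTI; exact: measurable_funPT.
have sub : [set w | t <= `|X w - a|] `<=`
    X @^-1` `]-oo, (a - t)%R] `|` X @^-1` `[(a + t)%R, +oo[.
  move=> w /=; rewrite !in_itv/= andbT ler_normr => /orP[]h; [right|left]; lra.
have : (2 * p)%:E = (p%:E + p%:E)%E by rewrite -EFinD; congr _%:E; lra.
move=> E; rewrite -(@leeD2lE _ p%:E)// -E.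
apply: (le_trans (Xt a)).
apply: le_trans (leeD (ltW aA) (lexx _)).
apply: le_trans (measureU2 P (mX _ _) (mX _ _)) => //.
apply: le_measure; rewrite ?inE //; last by apply: measurableU; exact: mX.
have -> : [set w | t <= `|X w - a|] = X @^-1` [set x | t <= `|x - a|] by [].
apply: mX.
have -> : [set x | t <= `|x - a|] = `]-oo, (a - t)%R] `|` `[(a + t)%R, +oo[.
  apply/seteqP; split => x /=; rewrite !in_itv/= andbT ler_normr.
    by move=> /orP[]h; [right|left]; lra.
  by case=> h; apply/orP; [right|left]; lra.
exact: measurableU.
Qed.
End quantile.

(** * Independent variables rarely come close to a subspace *)

Section near_subspace.
Context d (T : measurableType d) (R : realType) (P : probability T R).
Variables (N m k : nat) (xi : 'I_N -> {RV P >-> R}).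
Variables (p t eta : R) (a : 'I_N -> R).
Hypothesis xi_indep : mutually_independent P xi.
Hypotheses (p0 : 0 < p) (p1 : p < 1) (eta_t : 2 * eta <= t).
Hypothesis xi_low : forall i, (p%:E <= P (xi i @^-1` `]-oo, a i]))%E.
Hypothesis xi_high : forall i, (p%:E <= P (xi i @^-1` `[(a i + t)%R, +oo[))%E.

(** Values of [xi i] compatible with the side of the threshold [a i + t / 2]
    prescribed by the pattern [s]. *)
Let allowed (s : {set 'I_N}) i : set R :=
  if i \in s then `]a i, +oo[%classic else `]-oo, a i + t[%classic.

Let measurable_allowed s i : measurable (allowed s i).
Proof. by rewrite /allowed; case: ifP. Qed.

Let prob_allowed_le s i : (P (xi i @^-1` allowed s i) <= (1 - p)%R%:E)%E.
Proof.
have pC (A : set R) : measurable A -> (p%:E <= P (xi i @^-1` A))%E ->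
    (P (xi i @^-1` (~` A)) <= (1 - p)%R%:E)%E.
  move=> mA pA; rewrite preimage_setC probability_setC; last first.
    by rewrite -[X in measurable X]setTI; exact: measurable_funPT.
  by rewrite EFinB leeB.
rewrite /allowed; case: ifP => _; rewrite -[X in _ @^-1` X]setCK; apply: pC.
- exact: measurableC.
- by rewrite setCitvr.
- exact: measurableC.
- by rewrite setCitvl.
Qed.

(** The set [U] is the union, over sign patterns [s] and sets [J] of at most [k]
    exceptional indices, of the events that [xi i] is compatible with [s] for all
    [i] outside [J].  A measurable cover of the event of interest suffices for
    the union bound. *)
Lemma near_subspace_le (al : 'I_N -> 'I_m -> R) (V : 'I_m -> T -> R) :
    (m <= k)%N ->
  exists2 U, measurable U /\
    (P U <= (#|[set J : {set 'I_N} | (#|J| <= k)%N]%SET|%:R ^+ 2 *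
             (1 - p) ^+ (N - k))%R%:E)%E &
    forall w,
      (#|[pred i | (eta <= `|xi i w - \sum_(j < m) V j w * al i j|)%R]| <= k)%N ->
      U w.
Proof.
move=> mk; pose Js : {set {set 'I_N}} := [set J : {set 'I_N} | (#|J| <= k)%N]%SET.
pose S := sign_patterns al (fun i => a i + t / 2).
have SJs : (#|S| <= #|Js|)%N.
  apply: leq_trans (card_sign_patterns _ _) _; apply/subset_leq_card/fintype.subsetP.
  by move=> J; rewrite !inE => /leq_trans; exact.
pose A (q : {set 'I_N} * {set 'I_N}) : set T :=
  \bigcap_(i in [set` (~: q.2)%SET]) (xi i @^-1` allowed q.1 i).
have mA q : measurable (A q).
  apply: fin_bigcap_measurable => [|i _]; first exact: finite_finset.
  by rewrite -[X in measurable X]setTI; exact: measurable_funPT.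
have [mU PU] := @union_bound _ _ _ P _ (index_enum _)
  (mem (finset.setX S Js)) A (fun q _ => mA q).
exists (\big[setU/set0]_(q in finset.setX S Js) A q).
  split=> //; apply: (le_trans PU).
  apply: (@le_trans _ _ (\sum_(q in finset.setX S Js) ((1 - p) ^+ (N - k))%R%:E)%E).
    apply: lee_sum => -[s J] /finset.setXP[_ /=]; rewrite inE => Jk.
    rewrite /A xi_indep //.
    pose K (x : \bar R) (y : R) := (0 <= x)%E /\ (x <= y%:E)%E.
    have [_] : K (\prod_(i in (~: J)%SET) P (xi i @^-1` allowed s i))%E
        (\prod_(i in (~: J)%SET) (1 - p)).
      apply: (big_ind2 K) => [|x1 y1 x2 y2 [x1_0 xy1] [x2_0 xy2]|i _].
      - by split.
      - by split; rewrite ?mule_ge0// EFinM; exact: lee_pmul.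
      - by split.
    move=> /le_trans; apply; rewrite prodr_const lee_fin.
    have cardCJ : #|(~: J)%SET| = (N - #|J|)%N.
      by rewrite finset.cardsCs finset.setCK card_ord.
    apply: ler_wiXn2l; rewrite ?subr_ge0 ?(ltW p1)// ?gerBl ?(ltW p0)//.
    by apply: (@leq_trans (N - #|J|)%N); rewrite ?leq_sub2l// -cardCJ.
  rewrite sumEFin lee_fin sumr_const cardsX -[leLHS]mulr_natl.
  apply: ler_wpM2r; first by rewrite exprn_ge0 ?subr_ge0 ?ltW.
  by rewrite expr2 -natrM ler_nat leq_mul2r SJs orbT.
move=> w Dw.
pose J : {set 'I_N} :=
  [set i | eta <= `|xi i w - \sum_(j < m) V j w * al i j| ]%SET.
pose s : {set 'I_N} := [set i | a i + t / 2 < \sum_(j < m) V j w * al i j]%SET.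
have sJ : (s, J) \in finset.setX S Js.
  rewrite !inE /=; apply/andP; split; first by apply/asboolP; exists (V^~ w).
  by rewrite cardsE.
rewrite (bigD1 _ sJ) /=; left => i /=; rewrite !inE -ltNge => iJ.
have close (b x y : R) : `|x - y| < eta ->
    (b + t / 2 < y -> b < x) /\ (y <= b + t / 2 -> x < b + t).
  by have := eta_t; rewrite ltr_norml => ? /andP[? ?]; split; lra.
have [above below] := close (a i) _ _ iJ.
by rewrite /allowed; case: ifPn => /=; rewrite inE in_itv/= ?andbT -?leNgt.
Qed.
End near_subspace.

(** * Entropy of small sets against exponential decay *)

(** Exponential-moment bound for the number of small subsets: each of them
    contributes at least [x ^+ k] to the expansion of [(1 + x) ^+ #|I|]. *)
Lemma card_small_sets_le (R : realFieldType) (I : finType) (k : nat) (x : R) :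
  0 < x -> x <= 1 ->
  #|[set J : {set I} | (#|J| <= k)%N]%SET|%:R * x ^+ k <= (1 + x) ^+ #|I|.
Proof.
move=> x0 x1.
have -> : (1 + x) ^+ #|I| = \sum_(J : {set I}) x ^+ #|J|.
  have -> : (1 + x) ^+ #|I| = \prod_(i : I) (x + 1) by rewrite prodr_const addrC.
  rewrite bigA_distr; apply: eq_big => // J _.
  by rewrite -big_mkcond /= prodr_const.
rewrite -sum1_card natr_sum mulr_suml.
rewrite [leRHS](bigID (mem [set J : {set I} | (#|J| <= k)%N]%SET)) /=.
apply: ler_wpDr; first by apply: sumr_ge0 => J _; rewrite exprn_ge0 ?ltW.
apply: ler_sum => J; rewrite inE mul1r => Jk.
by apply: ler_wiXn2l => //; exact: ltW.
Qed.

Section constants.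
Variable R : realType.

Lemma card_small_sets_expR (I : finType) (k : nat) (x kappa : R) :
    0 < x -> x <= 1 -> k%:R <= kappa * #|I|%:R ->
  #|[set J : {set I} | (#|J| <= k)%N]%SET|%:R <=
  expR ((kappa * - ln x + x) * #|I|%:R).
Proof.
move=> x0 x1 kI; have := card_small_sets_le I k x0 x1.
rewrite -[X in _ * X ^+ k](lnK x0) -expRM_natr.
rewrite -ler_pdivlMr ?expR_gt0// -expRN => /le_trans; apply.
have : (1 + x) ^+ #|I| <= expR (x * #|I|%:R).
  by rewrite expRM_natr lerXn2r ?nnegrE ?expR_ge0 ?expR_ge1Dx//; lra.
move=> h; apply: (le_trans (ler_wpM2r (expR_ge0 _) h)).
have L0 : 0 <= - ln x by rewrite oppr_ge0 ln_le0.
by rewrite -expRD ler_expR; have := ler_wpM2r L0 kI; lra.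
Qed.

(** With [x = p / 8] and [kappa * (2 * - ln x + p) = p / 4], the two entropy
    factors cost at most [expR (p * N / 4 + 2 * kappa * - ln x * N)] and the decay
    gains [expR (- p * (1 - kappa) * N)], leaving [expR (- p * N / 2)]. *)
Lemma union_bound_half (p : R) : 0 < p -> p < 1 ->
  exists2 kappa : R, 0 < kappa &
    forall N k : nat, k%:R <= kappa * N%:R -> 2 / p <= N%:R ->
      #|[set J : {set 'I_N} | (#|J| <= k)%N]%SET|%:R ^+ 2 *
        (1 - p) ^+ (N - k) <= 1 / 2 :> R.
Proof.
move=> p0 p1; pose L := - ln (p / 8).
have L0 : 0 <= L by rewrite /L oppr_ge0 ln_le0//; lra.
pose kappa := p / (4 * (2 * L + p)).
have kE : kappa * (2 * L + p) = p / 4 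
  by rewrite /kappa invfM -!mulrA mulVf ?mulr1//; apply: lt0r_neq0; lra.
have k0 : 0 < kappa by rewrite divr_gt0//; lra.
have k1 : kappa <= 1 by nra.
exists kappa => // N k kN pN.
have kN' : (k <= N)%N.
  by rewrite -(ler_nat R) (le_trans kN)// ler_piMl.
have C : #|[set J : {set 'I_N} | (#|J| <= k)%N]%SET|%:R <=
    expR ((kappa * L + p / 8) * N%:R).
  have := @card_small_sets_expR 'I_N k (p / 8) kappa; rewrite card_ord.
  by apply => //; lra.
have B : (1 - p) ^+ (N - k) <= expR (- p * (N%:R - k%:R)).
  rewrite -natrB// expRM_natr lerXn2r ?nnegrE ?expR_ge0//; first lra.
  exact: expR_ge1Dx.
have C2 : #|[set J : {set 'I_N} | (#|J| <= k)%N]%SET|%:R ^+ 2 <=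
    expR ((kappa * L + p / 8) * N%:R) ^+ 2.
  by rewrite lerXn2r ?nnegrE ?expR_ge0.
apply: (@le_trans _ _ (expR (- (p * N%:R / 2)))).
  apply: le_trans (ler_pM _ _ C2 B) _; rewrite ?exprn_ge0//; first lra.
  rewrite -expRM_natr -expRD ler_expR.
  have := ler_wpM2l (ltW p0) kN; have := congr1 ( *%R^~ N%:R) kE => /=; lra.
rewrite expRN mul1r lef_pV2 ?posrE ?expR_gt0//.
apply: le_trans (expR_ge1Dx _).
move: pN; rewrite ler_pdivrMr//; lra.
Qed.
End constants.

(** * The Ky Fan norm and level sets *)

Section ky_fan_theory.
Context d (T : measurableType d) (R : realType) (P : probability T R).
Implicit Types (X Y : {mfun T >-> R}) (f : L0 P).

Lemma measurable_level X (t : R) : measurable [set w | t <= `|X w|].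
Proof.
rewrite -[X in measurable X]setTI.
have mX : measurable_fun setT (fun w => `|X w|).
  by apply: measurableT_comp => //; exact: measurable_funPT.
have := mX measurableT _ (measurable_itv `[t, +oo[).
by congr (measurable _); apply/seteqP; split=> w /=; rewrite in_itv/= andbT.
Qed.

Let levels X :=
  [set t : R | 0 <= t /\ (t%:E <= P [set w | (t <= `|X w|)%R])%E].

Let levels_ub X : has_ubound (levels X).
Proof.
exists 1 => t /= [_ tP]; rewrite -lee_fin (le_trans tP)// probability_le1//.
exact: measurable_level.
Qed.

Lemma toL0B X Y : toL0 P X - toL0 P Y = toL0 P (X - Y).
Proof. by rewrite -toL0D -toL0N. Qed.

Lemma ky_fan_ge0 f : 0 <= ky_fan f.
Proof. by apply: ub_le_sup (levels_ub (repr f)) _ _; split. Qed.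

Lemma prob_level_ky_fan_lt X Y t : 0 <= t -> ky_fan (toL0 P X - toL0 P Y) < t ->
  (P [set w | (t <= `|X w - Y w|)%R] <= t%:E)%E.
Proof.
rewrite toL0B ky_fan_toL0 => t0 XYt; rewrite leNgt; apply/negP => tP.
move: XYt; rewrite ltNge => /negP; apply.
by apply: ub_le_sup (levels_ub _) _ _; split=> //; apply: ltW.
Qed.

Lemma prob_level_lt_ky_fan X Y t : 0 <= t -> t < ky_fan (toL0 P X - toL0 P Y) ->
  (t%:E <= P [set w | (t <= `|X w - Y w|)%R])%E.
Proof.
rewrite toL0B ky_fan_toL0 => t0 /sup_gt[|s /= [s0 sP] ts].
  by exists 0; split.
apply: (@le_trans _ _ s%:E); first by rewrite lee_fin ltW.
apply: (le_trans sP); apply: le_measure; rewrite ?inE; try exact: (measurable_level (X - Y)).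
by move=> w /=; apply: le_trans; exact: ltW.
Qed.

(** The trivial bound [1] covers the case where the Ky Fan distance exceeds
    [eta], so that this form can be summed over a family without first discarding
    its badly approximated members. *)
Lemma prob_level_le (X Y : {mfun T >-> R}) eta : 0 < eta ->
  (P [set w | (eta <= `|X w - Y w|)%R] <=
   (eta + ky_fan (toL0 P X - toL0 P Y) / eta)%R%:E)%E.
Proof.
move=> eta0; set r := ky_fan _; have r0 : 0 <= r := ky_fan_ge0 _.
have [r_eta|eta_r] := ltP r eta.
  apply: (le_trans (prob_level_ky_fan_lt (ltW eta0) r_eta)).
  by rewrite lee_fin lerDl divr_ge0 // ltW.
apply: (@le_trans _ _ 1%:E); first exact: probability_le1 (measurable_level (X - Y) eta).
rewrite lee_fin -[leLHS]add0r lerD ?(ltW eta0)//.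
by rewrite ler_pdivlMr// mul1r.
Qed.

Lemma dist_to_lt (x : L0 P) Q e : Q !=set0 -> 0 < e ->
  exists2 y, Q y & ky_fan (x - y) < dist_to x Q + e.
Proof.
move=> [y Qy] e0; have [] := @inf_adherent _ [set ky_fan (x - y) | y in Q] e e0.
  split; first by exists (ky_fan (x - y)); exists y.
  by exists 0 => _ [z _ <-]; exact: ky_fan_ge0.
by move=> _ [z Qz <-] ?; exists z.
Qed.

(** A representative of a combination that is, at every outcome and not only
    almost surely, the same combination of values: this confines the vector of
    representatives to one subspace of [R^N]. *)
Lemma lin_comb_toL0 m (v : 'I_m -> L0 P) (a : 'I_m -> R) :
  exists2 Y : {mfun T >-> R}, \sum_j a j *: v j = toL0 P Y &
    forall w, Y w = \sum_j repr (v j) w * a j.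
Proof.
exists (\sum_j a j *: repr (v j)).
  have toL0_add : {morph toL0 P : X Y / X + Y} by move=> X Y; rewrite -toL0D.
  rewrite (big_morph _ toL0_add (erefl : toL0 P 0 = 0)).
  by apply: eq_bigr => j _; rewrite -toL0Z /toL0 reprK.
move=> w; rewrite (big_morph (fun X : {mfun T >-> R} => X w) (id1 := 0) (op1 := +%R)) //.
by apply: eq_bigr => j _; rewrite mulrC.
Qed.

End ky_fan_theory.

(** * Lower bound for the average distance *)

Section width_lower_bound.
Context d (T : measurableType d) (R : realType) (P : probability T R).
Variables (N : nat) (xi : 'I_N -> {RV P >-> R}) (eps : R).

(** A smaller average distance would provide approximations [Y i] whose expected
    number of failures [`|xi i - Y i| >= eta] is at most [2 * eta * N], that is,
    less than [k.+1 / 2].  But more than [k] failures occur outside the exceptional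
    set [U] of probability at most one half. *)
Lemma avg_dist_ge (m k : nat) (v : 'I_m -> L0 P) (eta : R) :
    mutually_independent P xi ->
    (forall i c, eps <= ky_fan (toL0 P (xi i) - toL0 P (cst c))) ->
    0 < eps -> eps < 1 ->
    0 < eta -> 4 * eta <= eps -> (m <= k)%N -> (0 < N)%N ->
    4 * eta * N%:R < k.+1%:R ->
    #|[set J : {set 'I_N} | (#|J| <= k)%N]%SET|%:R ^+ 2 *
      (1 - eps / 4) ^+ (N - k) <= 1 / 2 :> R ->
  eta ^+ 2 / 2 <= N%:R^-1 * \sum_(i < N)
    dist_to (toL0 P (xi i)) (range (fun a : 'I_m -> R => \sum_j a j *: v j)).
Proof.
move=> indep far eps0 eps1 eta0 eta_eps mk N0 kN small.
have Npos : 0 < N%:R :> R by rewrite ltr0n.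
pose Q : set (L0 P) := range (fun a : 'I_m -> R => \sum_j a j *: v j).
rewrite -/Q leNgt; apply/negP => avg_small.
have [a xi_gap] : {a : 'I_N -> R & forall i,
    ((eps / 4)%:E <= P (xi i @^-1` `]-oo, a i]))%E /\
    ((eps / 4)%:E <= P (xi i @^-1` `[(a i + eps / 2)%R, +oo[))%E}.
  apply: (@choice _ _ (fun i b => ((eps / 4)%:E <= P (xi i @^-1` `]-oo, b]))%E /\
    ((eps / 4)%:E <= P (xi i @^-1` `[(b + eps / 2)%R, +oo[))%E)) => i.
  apply: quantile_gap; [lra|lra|lra|] => c.
  rewrite (_ : 2 * _ = eps / 2); last lra.
  apply: (@prob_level_lt_ky_fan _ _ _ _ (xi i) (cst c)); first lra.
  by apply: lt_le_trans (far i c); lra.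
pose e2 := eta ^+ 2 / 2.
have e20 : 0 < e2 by rewrite divr_gt0// exprn_gt0.
have Q0 : Q !=set0 by exists (\sum_j (0 : R) *: v j), (fun=> 0).
have [al al_near] : {al : 'I_N -> 'I_m -> R & forall i,
    ky_fan (toL0 P (xi i) - \sum_j al i j *: v j) <
      dist_to (toL0 P (xi i)) Q + e2}.
  apply: (@choice _ _ (fun i c => ky_fan (toL0 P (xi i) - \sum_j c j *: v j) <
      dist_to (toL0 P (xi i)) Q + e2)) => i.
  by have [_ [c _ <-] lt] := dist_to_lt (toL0 P (xi i)) Q0 e20; exists c.
have [Y YE] : {Y : 'I_N -> {mfun T >-> R} & forall i,
    \sum_j al i j *: v j = toL0 P (Y i) /\
    forall w, Y i w = \sum_j repr (v j) w * al i j}.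
  apply: (@choice _ _ (fun i Z => \sum_j al i j *: v j = toL0 P Z /\
    forall w, Z w = \sum_j repr (v j) w * al i j)) => i.
  by have [Z ? ?] := lin_comb_toL0 v (al i); exists Z.
have [U [mU PU] near_U] : exists2 U, measurable U /\ (P U <= (1 / 2)%:E)%E &
    forall w, (#|[pred i | (eta <= `|xi i w - Y i w|)%R]| <= k)%N -> U w.
  have p0 : 0 < eps / 4 by lra.
  have p1 : eps / 4 < 1 by lra.
  have eta_t : 2 * eta <= eps / 2 by lra.
  have [U [mU PU] near_U] := near_subspace_le indep p0 p1 eta_t
    (fun i => (xi_gap i).1) (fun i => (xi_gap i).2) al (fun j => repr (v j)) mk.
  exists U; first by split => //; rewrite (le_trans PU)// lee_fin.
  move=> w wk; apply: near_U; apply: leq_trans wk.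
  by apply/eq_leq/eq_card => i; rewrite !inE (YE i).2.
pose D i := [set w | eta <= `|xi i w - Y i w|].
have mD i : measurable (D i) by exact: (measurable_level (xi i - Y i)).
have count_ge : ((k.+1%:R)%:E * P (~` U) <= \sum_i P (D i))%E.
  apply: markov_count => // [|w Uw]; first exact: measurableC.
  rewrite ltnNge; apply/negP => wk; apply: Uw; apply: near_U.
  apply: leq_trans wk; apply/eq_leq/eq_card => i; rewrite !inE.
  by apply/idP/idP => [?|]; rewrite inE.
have sum_le : (\sum_i P (D i) <= (2 * eta * N%:R)%R%:E)%E.
  pose r i := ky_fan (toL0 P (xi i) - toL0 P (Y i)).
  apply: (@le_trans _ _ (\sum_i (eta + r i / eta)%R%:E)%E).
    by apply: lee_sum => i _; exact: prob_level_le.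
  rewrite sumEFin lee_fin big_split /= sumr_const card_ord -mulr_suml -mulr_natr.
  have r_le : \sum_i r i <= eta ^+ 2 * N%:R.
    apply: (@le_trans _ _ (\sum_i (dist_to (toL0 P (xi i)) Q + e2))).
      by apply: ler_sum => i _; rewrite /r -(YE i).1; exact: ltW.
    move: avg_small; rewrite mulrC ltr_pdivrMr// => /ltW avg_le.
    rewrite big_split /= sumr_const card_ord -mulr_natr.
    by apply: (le_trans (lerD avg_le (lexx _))); rewrite /e2; lra.
  suff : (\sum_i r i) / eta <= eta * N%:R by lra.
  by rewrite ler_pdivrMr//; lra.
have := le_trans count_ge sum_le.
rewrite probability_setC//.
have Ufin : P U \is a fin_num by exact: fin_num_measure.
move: PU; rewrite -(fineK Ufin) lee_fin => PU.
rewrite -EFinB -EFinM lee_fin => le_sum.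
have : k.+1%:R * (1 / 2) <= k.+1%:R * (1 - fine (P U)).
  by rewrite ler_wpM2l//; lra.
lra.
Qed.

End width_lower_bound.

Lemma subspace_dim_le_zero (R : realType) (V : lmodType R) n : subspace_dim_le n [set (0 : V)].
Proof.
split.
  split; first by rewrite !inE.
  by move=> a u v; rewrite !inE /= => -> ->; rewrite scaler0 addr0.
exists 0%N => //; exists (fun=> 0); split; first by move=> ? _ [].
apply/seteqP; split=> [_ ->|_ [a _ <-]]; last by rewrite big_ord0.
by exists (fun=> 0) => //; rewrite big_ord0.
Qed.

Theorem theorem1p2 (R : realType) (eps : R) (eps0 : 0 < eps) (eps1 : eps < 1) :
  exists2 delta : R, 0 < delta &
    forall (d : measure_display) (T : measurableType d) (P : probability T R)
      (N : nat) (xi : 'I_N -> {RV P >-> R}),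
      (0 < N)%N ->
      mutually_independent P xi ->
      (forall i : 'I_N,
        eps <= inf [set ky_fan (toL0 P (xi i) - toL0 P (cst c)) | c in [set: R]]) ->
      forall n : nat, n%:R <= delta * N%:R ->
        delta <= avg_width n (fun i => toL0 P (xi i)).
Proof.
have p0 : 0 < eps / 4 by lra.
have p1 : eps / 4 < 1 by lra.
have [kappa kappa0 small] := union_bound_half p0 p1.
(* [4 * eta * N <= kappa * N / 2 < k.+1], and [2 * eta] fits in the gap [eps / 2]. *)
pose eta := Num.min (kappa / 8) (eps / 4).
have eta0 : 0 < eta by rewrite lt_min; apply/andP; split; lra.
have eta_kappa : eta <= kappa / 8 by rewrite ge_min lexx.
have eta_eps : eta <= eps / 4 by rewrite ge_min lexx orbT.
have delta_eta : eta ^+ 2 / 2 <= eta / 2 by rewrite ler_pM2r//; nra.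
have delta0 : 0 < eta ^+ 2 / 2 by rewrite divr_gt0// exprn_gt0.
exists (eta ^+ 2 / 2) => // d T P N xi N0 indep far n nN.
have Npos : 0 < N%:R :> R by rewrite ltr0n.
apply: lb_le_inf.
  eexists; exists [set 0]; last reflexivity; exact: subspace_dim_le_zero.
have far_cst i c : eps <= ky_fan (toL0 P (xi i) - toL0 P (cst c)).
  apply: (le_trans (far i)); apply: ge_inf; last by exists c.
  by exists 0 => _ [b _ <-]; exact: ky_fan_ge0.
move=> _ [Q [_ [m mn [v [_ ->]]]] <-].
have [n0|n_gt0] := posnP n.
  move: mn v; rewrite n0 leqn0 => /eqP -> v.
  apply: (@le_trans _ _ (N%:R^-1 * \sum_(i < N) eps)).
    by rewrite sumr_const card_ord -[eps *+ N]mulr_natl mulKf ?gt_eqF//; lra.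
  rewrite ler_pM2l ?invr_gt0//; apply: ler_sum => i _.
  apply: lb_le_inf.
    by eexists; exists 0 => //; exists (fun=> 0) => //; rewrite big_ord0.
  move=> _ [_ [a _ <-] <-]; rewrite big_ord0.
  have <- : toL0 P (cst 0) = 0 by apply/toL0_eqP; exact: aeW.
  exact: far_cst.
have kN0 : 0 <= kappa * N%:R by rewrite mulr_ge0 ?ltW.
have /andP[kN kN1] := truncn_itv kN0.
set k := Num.truncn _ in kN kN1.
have delta_kappa : eta ^+ 2 / 2 <= kappa by lra.
apply: (@avg_dist_ge _ _ _ P N xi eps m k) => //; first lra.
- rewrite (leq_trans mn)// /k truncn_ge_nat//.
  by rewrite (le_trans nN)// ler_wpM2r// ltW.
- by apply: le_lt_trans kN1; rewrite ler_wpM2r ?ltW//; lra.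
apply: small => //.
(* From [1 <= n <= delta * N] and [delta <= eps / 8]. *)
have n1 : 1 <= n%:R :> R by rewrite ler1n.
rewrite ler_pdivrMr//.
have : 1 <= eta ^+ 2 / 2 * N%:R by lra.
have : eta ^+ 2 / 2 * N%:R <= eps / 4 / 2 * N%:R by rewrite ler_pM2r//; lra.
lra.
Qed.
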